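(* Let $p$ be even, and suppose that $X(p,C)$ is a triangle-free circulant graph containing a $p$-cycle for which the maximum independent subset is of size $\frac{p}{2}$. Then $$m(X(p,C))=\frac{p}{2}\binom{2|C|}{2}.$$
   Context: The (undirected) circulant graph $X(p,C)$ has node set $\mathbb{Z}/p\mathbb{Z}$. Its connection set is a subset of $\mathbb{Z}/p\mathbb{Z}$ closed under additive inverses, and $\{i,j\}$ is an edge exactly when $i-j$ lies in the connection set. The connection set is abbreviated by a subset $C\subset\{1,\ldots,\lfloor p/2\rfloor\}$ by omitting the additive inverse of each element, so that $\{i,j\}$ is an edge iff $i-j\equiv \pm c \pmod p$ for some $c\in C$; $|C|$ denotes the cardinality of this abbreviated set. An immorality of a directed acyclic graph (DAG) is an induced subgraph of the form $X\to Z\leftarrow Y$ (with $X,Y$ not adjacent). The immorality number $m(G)$ of an undirected graph $G$ is the maximum number of immoralities over all DAGs whose skeleton (underlying undirected graph) is $G$.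
   Formalization: The case p/2 ∈ C is excluded: there the graph is regular of degree 2|C|−1 and the stated formula always fails, e.g. X(6,{1,3}) = K_{3,3} has m = 9 while the formula gives 18. *)

(* Defs.v *)
From HB Require Import structures.
From mathcomp Require Import all_boot all_algebra.

Set Implicit Arguments.
Unset Strict Implicit.
Unset Printing Implicit Defensive.

Import GRing.Theory.

(* An undirected graph is an adjacency relation on a finite type of vertices;
   a directed graph is given by its set of arcs. *)
Section Graphs.
Variable T : finType.
Implicit Types (e : rel T) (S : {set T}) (D : {set T * T}).

Definition triangle_free e : Prop :=
  forall x y z, ~~ [&& e x y, e y z & e z x].

(* [ucycle] alone would count a single edge as a 2-cycle. *)
Definition contains_cycle e (n : nat) : Prop :=
  2 < n /\ exists2 c : seq T, ucycle e c & size c = n.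

Definition independent e S : bool :=
  [forall x in S, forall y in S, ~~ e x y].

Definition independence_number e : nat :=
  \max_(S : {set T} | independent e S) #|S|.

Definition arc D : rel T := [rel x y | (x, y) \in D].

Definition acyclic D : bool :=
  [forall x, forall y, arc D x y ==> ~~ connect (arc D) y x].

Definition skeleton D : rel T := [rel x y | arc D x y || arc D y x].

Definition is_skeleton e D : bool :=
  [forall x, forall y, e x y == skeleton D x y].

(* The immorality x -> z <- y is recorded as (z, {x, y}), so that swapping
   x and y does not count it twice. *)
Definition immoralities D : {set T * {set T}} :=
  [set I | [exists x, exists y, exists z,
     [&& I == (z, [set x; y]), x != y, arc D x z, arc D y z
       & ~~ skeleton D x y]]].

Definition immorality_number e : nat :=
  \max_(D : {set T * T} | acyclic D && is_skeleton e D) #|immoralities D|.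

Lemma acyclicP D :
  reflect (forall c : seq T, cycle (arc D) c -> c = [::]) (acyclic D).
Proof.
apply: (iffP forallP) => [acD [//|x c] /= | noC x].
  rewrite rcons_path => /andP[pc lx]; have /forallP/(_ x) := acD (last x c).
  by rewrite lx /=; case/negP; apply/connectP; exists c.
apply/forallP => y; apply/implyP => xy; apply/negP => /connectP[c pc def_x].
have /noC// : cycle (arc D) (y :: c).
by rewrite /= rcons_path pc -def_x.
Qed.

End Graphs.

Section Circulant.
Variable p : nat.
Implicit Type C : {set 'Z_p}.
Local Open Scope ring_scope.

Definition connection_set C : {set 'Z_p} := C :|: [set - c | c in C].

Definition circulant C : rel 'Z_p := [rel i j | i - j \in connection_set C].

End Circulant.

(* Main.v *)
Require Import Defs.
From HB Require Import structures.
From mathcomp Require Import all_boot all_algebra.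

(* In a triangle-free graph any two in-neighbours of z are non-adjacent, so a DAG
   has \sum_z 'C(indeg z, 2) immoralities. If the graph is d-regular, then
   'C(indeg z, 2) <= indeg z * (d - 1) / 2, and the in-degrees add up to half of the
   degree sum; this is the upper bound. It is attained by directing all edges
   at a maximum independent set S towards S, and the others acyclically. *)

Set Implicit Arguments.
Unset Strict Implicit.
Unset Printing Implicit Defensive.

Section Orientations.
Variable T : finType.
Implicit Types (e : rel T) (S : {set T}) (D : {set T * T}).
(* [arc] would otherwise be [path.arc]. *)
Local Notation arc := Defs.arc.

Definition in_nbrs D (z : T) : {set T} := [set x | arc D x z].

Lemma triangle_free_irr e : triangle_free e -> irreflexive e.
Proof. by move=> tf x; apply/negbTE/negP => exx; have := tf x x x; rewrite exx. Qed.

Lemma is_skeletonP e D : reflect (e =2 skeleton D) (is_skeleton e D).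
Proof.
apply: (iffP forallP) => [h x y | h x].
  by have /forallP/(_ y)/eqP := h x.
by apply/forallP => y; rewrite h.
Qed.

Lemma acyclic_asym D x y : acyclic D -> arc D x y -> ~~ arc D y x.
Proof.
move/forallP/(_ x)/forallP/(_ y)/implyP => h xy.
by apply: contra (h xy); apply: connect1.
Qed.

Lemma immoralities_triangle_free e D :
  triangle_free e -> is_skeleton e D ->
  immoralities D = [set I : T * {set T} | (I.2 \subset in_nbrs D I.1) && (#|I.2| == 2)].
Proof.
move=> tf /is_skeletonP sk; apply/setP => -[z B]; rewrite !inE /=.
apply/idP/idP.
  case/existsP=> x /existsP[y /existsP[z' /and5P[/eqP[-> ->] xy xz yz _]]].
  by rewrite cards2 xy andbT subUset !sub1set !inE xz yz.
case/andP=> sB /cards2P[x [y [xy def_B]]]; move: sB.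
rewrite def_B subUset !sub1set !inE => /andP[xz yz].
apply/existsP; exists x; apply/existsP; exists y; apply/existsP; exists z.
rewrite eqxx xy xz yz /=; apply/negP => sxy; have := tf x y z.
by rewrite !sk sxy /skeleton /= xz yz /= !orbT.
Qed.

Lemma card_immoralities_triangle_free e D :
  triangle_free e -> is_skeleton e D ->
  #|immoralities D| = \sum_z 'C(#|in_nbrs D z|, 2).
Proof.
move=> tf sk; rewrite (immoralities_triangle_free tf sk) -sum1dep_card.
under [RHS]eq_bigr => z _ do rewrite -cards_draws -sum1dep_card.
by rewrite pair_big_dep; apply: eq_bigl => -[].
Qed.

Lemma card_in_nbrs_le e D z :
  is_skeleton e D -> #|in_nbrs D z| <= #|[set y | e z y]|.
Proof.
move/is_skeletonP => sk; apply/subset_leq_card/subsetP => x.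
by rewrite !inE sk /skeleton /= => ->; rewrite orbT.
Qed.

(** Each edge is counted once at its head and once at its tail; acyclicity rules out edges directed
    both ways. *)
Lemma sum_degrees_orientation e D :
  acyclic D -> is_skeleton e D ->
  \sum_z #|[set y | e z y]| = 2 * \sum_z #|in_nbrs D z|.
Proof.
move=> ac /is_skeletonP sk.
have deg z : #|[set y | e z y]| = #|in_nbrs D z| + #|[set y | arc D z y]|.
  have dis : in_nbrs D z :&: [set y | arc D z y] = set0.
    apply/setP => y; rewrite !inE; apply/negP => /andP[yz zy].
    by have := acyclic_asym ac yz; rewrite zy.
  rewrite -cardsUI dis cards0 addn0.
  by apply: eq_card => y; rewrite !inE sk /skeleton /= orbC.
rewrite (eq_bigr _ (fun z _ => deg z)) big_split /= mul2n -addnn; congr (_ + _).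
under eq_bigr => z _ do rewrite -sum1dep_card.
under [RHS]eq_bigr => z _ do rewrite -sum1dep_card.
(* Counting arcs by tail or by head gives the same total. *)
by rewrite (exchange_big_dep predT).
Qed.

Lemma immorality_number_le e d :
  triangle_free e -> (forall z, #|[set y | e z y]| = d) ->
  2 * immorality_number e <= #|T| * 'C(d, 2).
Proof.
(* Moving the factor 2 to the right isolates the maximum, so that the bound can be checked for each
   [D] separately. *)
move=> tf reg; rewrite mulnC -leq_divRL //.
apply/bigmax_leqP => D /andP[ac sk]; rewrite leq_divRL // mulnC.
rewrite (card_immoralities_triangle_free tf sk) -(leq_pmul2l (isT : 0 < 2)).
have two_bin n : 2 * 'C(n, 2) = n * n.-1 by rewrite -mul_bin_diag bin1.
rewrite (mulnCA _ #|T|) two_bin [leqRHS]mulnA.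
have -> : #|T| * d = 2 * \sum_z #|in_nbrs D z|.
  rewrite -(sum_degrees_orientation ac sk) (eq_bigr (fun=> d)) => [|z _]//.
  by rewrite sum_nat_const.
(* With [n] the in-degree of [z], it remains to see that [n * n.-1 <= n * d.-1]. *)
rewrite -mulnA leq_pmul2l // big_distrr big_distrl leq_sum //= => z _.
rewrite two_bin leq_mul2l; apply/orP; right.
by rewrite -!subn1 leq_sub2r // -(reg z) card_in_nbrs_le.
Qed.

Lemma immorality_number_ge e d S :
  symmetric e -> triangle_free e -> (forall z, #|[set y | e z y]| = d) ->
  independent e S -> #|S| * 'C(d, 2) <= immorality_number e.
Proof.
move=> sym tf reg /forall_inP indS.
(* Since ranks are below [#|T|], the shift puts every vertex of [S] after all the others. Edges are
   directed towards larger [f]. *)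
pose f x := enum_rank x + (x \in S) * #|T|.
pose D := [set a : T * T | e a.1 a.2 && (f a.1 < f a.2)].
have arcE x y : arc D x y = e x y && (f x < f y) by rewrite /arc /= inE.
have f_inj x y : f x = f y -> x = y.
  (* Reduction modulo [#|T|] removes the shift and leaves the rank. *)
  move=> /(congr1 (modn^~ #|T|)); rewrite /f /=.
  by rewrite ![_ + _ * _]addnC !modnMDl !modn_small // => /ord_inj/enum_rank_inj.
have ac : acyclic D.
  apply/forallP => x; apply/forallP => y; apply/implyP; rewrite arcE => /andP[_ fxy].
  apply/negP => /connectP[c pc def_x].
  (* A path from [y] back to [x] cannot decrease [f], against [f x < f y]. *)
  have : f y <= f x.
    rewrite def_x {def_x fxy}; elim: c y pc => //= z c IH y /andP[yz /IH].
    apply: leq_trans; move: yz.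
    by rewrite -[X in is_true X]/(arc D y z) arcE => /andP[_ /ltnW].
  by rewrite leqNgt fxy.
have sk : is_skeleton e D.
  apply/is_skeletonP => x y; rewrite /skeleton /= -/(arc D x y) -/(arc D y x) !arcE.
  rewrite (sym y x) -andb_orr -neq_ltn.
  case exy: (e x y) => //=; apply/esym/eqP => /f_inj def_y.
  by rewrite def_y triangle_free_irr in exy.
(* By independence all neighbours of [z] lie outside [S], so every edge at [z] enters [z]. *)
have full z : z \in S -> #|in_nbrs D z| = d.
  move=> zS; rewrite -(reg z); apply: eq_card => x; rewrite !inE arcE sym /=.
  case ezx: (e z x) => //=.
  have xS : x \notin S.
    by apply/negP => xS; have /forall_inP/(_ x xS) := indS z zS; rewrite ezx.
  rewrite /f zS (negbTE xS) mul0n mul1n addn0.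
  exact: leq_trans (ltn_ord _) (leq_addl _ _).
apply: leq_trans (leq_bigmax_cond (F := fun D => #|immoralities D|) D _); last first.
  by rewrite ac.
rewrite (card_immoralities_triangle_free tf sk) (bigID (mem S)) /=.
rewrite (eq_bigr (fun=> 'C(d, 2))) => [|z /full ->//].
by rewrite sum_nat_const leq_addr.
Qed.

Lemma independence_number_attained e :
  exists2 S, independent e S & #|S| = independence_number e.
Proof.
have ind0 : independent e set0 by apply/forall_inP => x; rewrite inE.
rewrite /independence_number (bigmax_eq_arg set0) //.
by case: arg_maxnP => // S indS _; exists S.
Qed.

End Orientations.

Section CirculantGraphs.
Import GRing.Theory.
Variable p : nat.
Implicit Type C : {set 'Z_p}.
Local Open Scope ring_scope.

Lemma connection_setN C x : (- x \in connection_set C) = (x \in connection_set C).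
Proof.
have mN y : (y \in [set - c | c in C]) = (- y \in C).
  by rewrite -{1}(opprK y) mem_imset //; apply: oppr_inj.
by rewrite !in_setU !mN opprK orbC.
Qed.

Lemma circulant_sym C : symmetric (circulant C).
Proof. by move=> x y; rewrite /circulant /= -connection_setN opprB. Qed.

Lemma circulant_degree C z :
  #|[set y | circulant C z y]| = #|connection_set C|.
Proof.
(* The injection [y |-> z - y] maps the neighbours of [z] onto the connection set. *)
rewrite -(card_imset _ (@subrI _ z)); apply: eq_card => c.
apply/imsetP/idP => [[y + ->] | Cc]; first by rewrite inE.
by exists (z - c); rewrite ?inE /circulant /= opprB addrC subrK.
Qed.

(** No element of [C] is the inverse of another or of itself: the representatives of two inverse
    nonzero residues add up to [p], but those in [C] lie below [p / 2]. *)
Lemma card_connection_set C :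
  (1 < p)%N -> (forall c, c \in C -> (0 < c) && (c.*2 < p))%N ->
  #|connection_set C| = (2 * #|C|)%N.
Proof.
move=> p_gt1 rangeC.
suff dis : C :&: [set - c | c in C] = set0.
  by rewrite cardsU dis cards0 subn0 card_imset ?addnn ?mul2n //; exact: oppr_inj.
apply/setP => x; rewrite !inE; apply/negP => /andP[Cx /imsetP[c Cc def_x]].
have /andP[_ ltx] := rangeC _ Cx; have /andP[c0 ltc] := rangeC _ Cc.
have px : (x + c = p :> nat)%N.
  rewrite -[RHS](Zp_cast p_gt1) def_x /= modn_small ?subnK //.
    by rewrite ltnW ?ltn_ord.
  by rewrite ltn_subrL c0.
have: (x + c < p)%N.
  by rewrite -ltn_double doubleD -[p.*2]addnn (leq_add ltx (ltnW ltc)).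
by rewrite px ltnn.
Qed.

End CirculantGraphs.

(* C consists of representatives in {1, ..., p/2}. The hypothesis [p_half]
   excludes the self-inverse element p/2, for which the graph would have
   degree 2|C| - 1 and the formula would fail, as for K_{3,3} = X(6, {1, 3}). *)
Theorem corollary2p11 (p : nat) (C : {set 'Z_p})
    (p_gt1 : 1 < p) (p_even : ~~ odd p)
    (C_range : forall c : 'Z_p, c \in C -> 1 <= (c : nat) <= p./2)
    (p_half : forall c : 'Z_p, c \in C -> (c : nat) <> p./2)
    (tri_free : triangle_free (circulant C))
    (p_cycle : contains_cycle (circulant C) p)
    (max_indep : independence_number (circulant C) = p./2) :
  immorality_number (circulant C) = p./2 * 'C(2 * #|C|, 2).
Proof.
have deg z : #|[set y | circulant C z y]| = 2 * #|C|.
  rewrite circulant_degree card_connection_set // => c Cc.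
  have /andP[-> c_le] := C_range c Cc.
  (* As [p] is twice [p./2], the strict bound amounts to [c <= p./2] together with [c <> p./2]. *)
  rewrite -[X in _ < X](even_halfK p_even) ltn_double ltn_neqAle c_le andbT.
  exact/eqP/p_half.
apply/eqP; rewrite eqn_leq; apply/andP; split.
  rewrite -(leq_pmul2l (isT : 0 < 2)) mulnA (mul2n p./2) even_halfK //.
  have cardZ : #|'Z_p| = p by rewrite card_ord Zp_cast.
  by have := immorality_number_le tri_free deg; rewrite cardZ.
have [S indS cardS] := independence_number_attained (circulant C).
rewrite -max_indep -cardS.
exact: immorality_number_ge (@circulant_sym _ C) tri_free deg indS.
Qed.
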